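(* Let $\mathbb K$ be a d-minimal first-order topological structure, and let $X\subseteq\mathbb K$. Then $X$ is dense in $\mathbb K$ with respect to the matroid $\mathrm{Zcl}$ (i.e. $U\cap X\neq\emptyset$ for every $\mathbb K$-definable $U\subseteq\mathbb K$ with $\dim(U)=1$, where $\dim$ is the dimension induced by $\mathrm{Zcl}$) if and only if $X$ is topologically dense in $\mathbb K$.
   Context: A first-order topological structure is a structure $\mathbb K$ with a topology having as a basis the family $\{\Phi(\mathbb K,\bar a):\bar a\in\mathbb K^m\}$ for some fixed formula $\Phi(x,\bar y)$ without parameters; $\mathbb K^n$ carries the product topology, and elementary extensions of $\mathbb K$ are topologized using the same $\Phi$. ''Definable'' means definable with parameters. Let $\mathbb M\succeq\mathbb K$ be a monster model ($\kappa$-saturated, strongly $\kappa$-homogeneous, $\kappa$ large). $\mathbb K$ is d-minimal if: 1. points of $\mathbb K$ are closed ($\mathbb K$ is $T_1$); 2. $\mathbb K$ has no isolated points; 3. every definable $X\subseteq\mathbb M$ (parameters in $\mathbb M$) with empty interior is a finite union of discrete sets; 4. for every definable discrete $X\subset\mathbb K^n$, the projection of $X$ onto the first coordinate has empty interior; 5. given definable $X\subseteq\mathbb K^2$ and $U\subseteq\Pi^2_1(X)$ (where $\Pi^2_1$ is the projection onto the first coordinate), if $U$ is open and non-empty and $X_a=\{t:(a,t)\in X\}$ has non-empty interior for every $a\in U$, then $X$ has non-empty interior. For $A\subset\mathbb M$ and $b\in\mathbb M$: $b\in\mathrm{Zcl}(A)$ iff there is an $A$-definable $X\subset\mathbb M$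 with empty interior and $b\in X$; this is a matroid (pregeometry) on $\mathbb M$. The rank $\mathrm{rk}(\bar b/A)$ is the cardinality of a maximal subtuple of $\bar b$ that is $\mathrm{Zcl}$-independent over $A$. For $V\subseteq\mathbb M^n$ definable over a set $A$ with $|A|<\kappa$, $\dim(V)=\max\{\mathrm{rk}(\bar b/A):\bar b\in V\}$ and $\dim(\emptyset)=-\infty$. The dimension of a $\mathbb K$-definable set is that of its interpretation in $\mathbb M$. *)

(* Defs.v *)
From mathcomp Require Import all_boot all_order.
From mathcomp Require Import all_classical topology function_spaces.

Set Implicit Arguments.
Unset Strict Implicit.
Unset Printing Implicit Defensive.

Local Open Scope classical_set_scope.
Local Open Scope card_scope.

(* T^n; prod_topology carries the product topology. *)
Definition pow (T : Type) (n : nat) := prod_topology (fun _ : 'I_n => T).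

Definition cat_asg (T : Type) (n m : nat) (x : 'I_n -> T) (a : 'I_m -> T) :
    'I_(n + m) -> T :=
  fun i => match fintype.split i with inl k => x k | inr k => a k end.

Definition pt (T : Type) (a : T) : 'I_1 -> T := fun=> a.

Definition set_pow1 (T : Type) (X : set T) : set (pow T 1) :=
  [set x | X (x ord0)].

Definition card_lt (T U : Type) (A : set T) (B : set U) : bool :=
  (A #<= B) && ~~ (B #<= A).

Record signature := Signature {
  fsym : Type;
  farity : fsym -> nat;
  rsym : Type;
  rarity : rsym -> nat }.

Record interp (L : signature) (T : Type) := Interp {
  fint : forall f : fsym L, ('I_(farity f) -> T) -> T;
  rint : forall r : rsym L, ('I_(rarity r) -> T) -> Prop }.

Inductive term (L : signature) (n : nat) : Type :=
| Var of 'I_n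
| App (f : fsym L) of ('I_(farity f) -> term L n).

(* [formula L n]: formulas with free variables among x_0, .., x_(n-1).
   [All] binds the variable of index 0 of its body and shifts the others.
   The remaining connectives are definable, the semantics being classical. *)
Inductive formula (L : signature) : nat -> Type :=
| Fls n : formula L n
| Equ n of term L n & term L n : formula L n
| Rel n (r : rsym L) of ('I_(rarity r) -> term L n) : formula L n
| Imp n of formula L n & formula L n : formula L n
| All n of formula L (1 + n) : formula L n.

Fixpoint eval (L : signature) (T : Type) (I : interp L T) (n : nat)
    (v : 'I_n -> T) (t : term L n) : T :=
  match t with
  | Var i => v i
  | App f ts => fint I (fun k : 'I_(farity f) => eval I v (ts k))
  end.

Fixpoint sat (L : signature) (T : Type) (I : interp L T) (n : nat)
    (p : formula L n) : ('I_n -> T) -> Prop :=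
  match p in formula _ n return ('I_n -> T) -> Prop with
  | Fls _ => fun _ => False
  | Equ _ t u => fun v => eval I v t = eval I v u
  | Rel _ r ts => fun v => rint I (fun k : 'I_(rarity r) => eval I v (ts k))
  | Imp _ p q => fun v => sat I p v -> sat I q v
  | All _ p => fun v => forall a : T, sat I p (cat_asg (pt a) v)
  end.

(* Formulas in n free variables with parameters in T. *)
Record pformula (L : signature) (T : Type) (n : nat) := PFormula {
  pf_num : nat;
  pf_fml : formula L (n + pf_num);
  pf_par : 'I_pf_num -> T }.

Definition pset (L : signature) (T : Type) (I : interp L T) (n : nat)
    (p : pformula L T n) : set (pow T n) :=
  [set x | sat I (pf_fml p) (cat_asg x (@pf_par L T n p))].

Definition par_in (L : signature) (T : Type) (n : nat) (A : set T)
    (p : pformula L T n) : Prop :=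
  forall i, A (@pf_par L T n p i).

Definition pf_map (L : signature) (T U : Type) (j : T -> U) (n : nat)
    (p : pformula L T n) : pformula L U n :=
  PFormula (pf_fml p) (fun i => j (@pf_par L T n p i)).

Definition definable_over (L : signature) (T : Type) (I : interp L T)
    (A : set T) (n : nat) (X : set (pow T n)) : Prop :=
  exists2 p : pformula L T n, par_in A p & X = pset I p.

Definition definable (L : signature) (T : Type) (I : interp L T)
    (n : nat) (X : set (pow T n)) : Prop :=
  definable_over I [set: T] X.

(* M is an elementary extension of K, up to the identification of K with its
   image under j (injectivity of j follows by taking an equality for p). *)
Definition elementary (L : signature) (K M : Type) (IK : interp L K)
    (IM : interp L M) (j : K -> M) : Prop :=
  forall (n : nat) (p : formula L n) (v : 'I_n -> K),
    sat IK p v <-> sat IM p (j \o v).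

(* The cardinal kappa is given as a type of that cardinality. *)
Definition small (kappa T : Type) (A : set T) : bool :=
  card_lt A [set: kappa].

Definition saturated (L : signature) (kappa M : Type) (IM : interp L M) :
    Prop :=
  forall (A : set M) (p : set (pformula L M 1)),
    small kappa A ->
    (forall q, p q -> par_in A q) ->
    (forall F, finite_set F -> F `<=` p ->
       exists b : M, forall q, F q -> pset IM q (pt b)) ->
    exists b : M, forall q, p q -> pset IM q (pt b).

Definition automorphism (L : signature) (M : Type) (IM : interp L M)
    (s : M -> M) : Prop :=
  [/\ bijective s,
      forall (f : fsym L) (v : 'I_(farity f) -> M),
        s (fint IM v) = fint IM (s \o v)
    & forall (r : rsym L) (v : 'I_(rarity r) -> M),
        rint IM v <-> rint IM (s \o v)].

Definition partial_elementary (L : signature) (M : Type) (IM : interp L M)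
    (A : set M) (g : M -> M) : Prop :=
  forall (n : nat) (p : formula L n) (v : 'I_n -> M),
    (forall i, A (v i)) -> (sat IM p v <-> sat IM p (g \o v)).

Definition strongly_homogeneous (L : signature) (kappa M : Type)
    (IM : interp L M) : Prop :=
  forall (A : set M) (g : M -> M),
    small kappa A -> partial_elementary IM A g ->
    exists2 s : M -> M, automorphism IM s & forall a, A a -> s a = g a.

Record monster (L : signature) (kappa K M : Type) (IK : interp L K)
    (IM : interp L M) (j : K -> M) : Prop := Monster {
  monster_elementary : elementary IK IM j;
  monster_saturated : saturated kappa IM;
  monster_homogeneous : strongly_homogeneous kappa IM;
  monster_large_nat : small kappa [set: nat];
  monster_large_fsym : small kappa [set: fsym L];
  monster_large_rsym : small kappa [set: rsym L];
  monster_large_K : small kappa [set: K] }.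

Definition fo_topological (L : signature) (m : nat) (Phi : formula L (1 + m))
    (T : topologicalType) (I : interp L T) : Prop :=
  basis [set U : set T | exists a : 'I_m -> T,
           U = [set x | sat I Phi (cat_asg (pt x) a)]].

Definition discrete_set (T : topologicalType) (D : set T) : Prop :=
  isolated D = D.

Definition first_proj (T : Type) (n : nat) (X : set (pow T n.+1)) : set T :=
  [set x ord0 | x in X].

Definition fiber (T : Type) (X : set (pow T 2)) (a : T) : set T :=
  [set t | X (cat_asg (pt a) (pt t))].

Record d_minimal (L : signature) (K M : topologicalType) (IK : interp L K)
    (IM : interp L M) : Prop := DMinimal {
  dmin_T1 : forall x : K, closed [set x];
  dmin_no_isolated : isolated [set: K] = set0;
  dmin_finite_union : forall X : set M,
    definable IM (set_pow1 X) -> X° = set0 ->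
    exists (N : nat) (D : 'I_N -> set M),
      (forall i, discrete_set (D i)) /\ X = \bigcup_i D i;
  dmin_proj : forall (n : nat) (X : set (pow K n.+1)),
    definable IK X -> discrete_set X -> (first_proj X)° = set0;
  dmin_fiber : forall (X : set (pow K 2)) (U : set K),
    definable IK X -> U `<=` first_proj X -> open U -> U !=set0 ->
    (forall a, U a -> (fiber X a)° !=set0) -> X° !=set0 }.

Definition Zcl (L : signature) (M : topologicalType) (IM : interp L M)
    (A : set M) : set M :=
  [set b | exists X : set M,
     [/\ definable_over IM A (set_pow1 X), X° = set0 & X b]].

Definition Zcl_independent (L : signature) (M : topologicalType)
    (IM : interp L M) (A : set M) (n : nat) (b : pow M n) (S : {set 'I_n}) :
    Prop :=
  forall i, i \in S ->
    ~ Zcl IM (A `|` [set b k | k in [set k | k \in S /\ k != i]]) (b i).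

Definition is_rk (L : signature) (M : topologicalType)
    (IM : interp L M) (A : set M) (n : nat) (b : pow M n) (r : nat) : Prop :=
  exists2 S : {set 'I_n},
    maxset (fun S => `[< Zcl_independent IM A b S >]) S & #|S| = r.

(* [None] stands for -oo. *)
Definition is_dim_over (L : signature) (M : topologicalType)
    (IM : interp L M) (A : set M) (n : nat) (V : set (pow M n))
    (d : option nat) : Prop :=
  if d is Some d then
    (exists2 b, V b & is_rk IM A b d) /\
    (forall b r, V b -> is_rk IM A b r -> (r <= d)%N)
  else V = set0.

(* The value does not depend on the small set of definition A. *)
Definition is_dim (L : signature) (kappa : Type) (M : topologicalType)
    (IM : interp L M) (n : nat) (V : set (pow M n)) (d : option nat) : Prop :=
  exists A : set M,
    [/\ small kappa A, definable_over IM A V & is_dim_over IM A V d].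

(* [pset IM (pf_map j p)] is the interpretation in M of [pset IK p]. *)
Definition Zcl_dense (L : signature) (kappa : Type) (K M : topologicalType)
    (IK : interp L K) (IM : interp L M) (j : K -> M) (X : set K) : Prop :=
  forall (U : set K) (p : pformula L K 1),
    set_pow1 U = pset IK p ->
    is_dim kappa IM (pset IM (pf_map j p)) (Some 1) ->
    U `&` X !=set0.

(* Main.v *)
(* A K-definable U has dimension 1 iff it has non-empty interior.
   In M, a set with empty interior that is definable is a finite union of
   discrete sets, and these are nowhere dense, since the facts that points are
   closed but not open pass from K to M. So, by saturation, a non-empty open
   definable set contains a point avoiding all the sets with empty interior
   definable over a given small set. Conversely, a definable set of dimension 1
   cannot have empty interior, since it would witness that its points are in
   Zcl; and "contains a non-empty basic open set" passes from M back to K. *)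
Require Import Defs.
From mathcomp Require Import all_boot all_order.
From mathcomp Require Import all_classical topology function_spaces.

Set Implicit Arguments.
Unset Strict Implicit.
Unset Printing Implicit Defensive.

Local Open Scope classical_set_scope.

(** * Concatenation of assignments *)

Section Assignments.
Variable T : Type.

Lemma cat_asg_lshift n k (x : 'I_n -> T) (a : 'I_k -> T) (i : 'I_n) :
  cat_asg x a (lshift k i) = x i.
Proof. by rewrite /cat_asg -/(unsplit (inl i)) unsplitK. Qed.

Lemma cat_asg_rshift n k (x : 'I_n -> T) (a : 'I_k -> T) (i : 'I_k) :
  cat_asg x a (rshift n i) = a i.
Proof. by rewrite /cat_asg -/(unsplit (inr i)) unsplitK. Qed.

Lemma cat_asgP n k (w : 'I_(n + k) -> T) (x : 'I_n -> T) (a : 'I_k -> T) :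
  w \o @lshift n k = x -> w \o @rshift n k = a -> w = cat_asg x a.
Proof.
move=> <- <-; apply: funext => i; rewrite -{1}(splitK i) /cat_asg.
by case: (fintype.split i).
Qed.

Lemma cat_asgK n k (w : 'I_(n + k) -> T) :
  cat_asg (w \o @lshift n k) (w \o @rshift n k) = w.
Proof. by apply/esym/cat_asgP. Qed.

Lemma pt_eta (x : 'I_1 -> T) : pt (x ord0) = x.
Proof. by apply: funext => i; rewrite (ord1 i). Qed.

End Assignments.

Lemma comp_cat_asg (T U : Type) (j : T -> U) n k (x : 'I_n -> T)
    (a : 'I_k -> T) :
  j \o cat_asg x a = cat_asg (j \o x) (j \o a).
Proof.
by apply: cat_asgP; apply: funext => i /=;
   rewrite ?cat_asg_lshift ?cat_asg_rshift.
Qed.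

(** * Renaming of free variables *)

Section Renaming.
Variable L : signature.

Fixpoint term_rename n k (f : 'I_n -> 'I_k) (t : term L n) : term L k :=
  match t with
  | Var i => Var L (f i)
  | App g ts => App (fun i => term_rename f (ts i))
  end.

Definition lift_rename n k (f : 'I_n -> 'I_k) : 'I_(1 + n) -> 'I_(1 + k) :=
  cat_asg (@lshift 1 k) (@rshift 1 k \o f).

(** [k] and the renaming come after the formula, since under [All] the recursive call is made with
    the lifted renaming. *)
Fixpoint rename n (p : formula L n) : forall k, ('I_n -> 'I_k) -> formula L k :=
  match p in formula _ n return forall k, ('I_n -> 'I_k) -> formula L k with
  | Fls _ => fun k f => Fls L k
  | Equ _ t u => fun k f => Equ (term_rename f t) (term_rename f u)
  | Rel _ r ts => fun k f => Rel (fun i => term_rename f (ts i))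
  | Imp _ p q => fun k f => Imp (rename p f) (rename q f)
  | All _ p => fun k f => All (rename p (lift_rename f))
  end.

Variables (T : Type) (I : interp L T).

Lemma eval_rename n k (f : 'I_n -> 'I_k) (v : 'I_k -> T) (t : term L n) :
  Defs.eval I v (term_rename f t) = Defs.eval I (v \o f) t.
Proof.
by elim: t => //= g ts IH; congr fint; apply: funext => i; apply: IH.
Qed.

Lemma sat_rename n (p : formula L n) k (f : 'I_n -> 'I_k) (v : 'I_k -> T) :
  sat I (rename p f) v <-> sat I p (v \o f).
Proof.
have lift_renameE n' k' (g : 'I_n' -> 'I_k') (u : 'I_k' -> T) a :
    cat_asg (pt a) u \o lift_rename g = cat_asg (pt a) (u \o g).
  rewrite /lift_rename comp_cat_asg; congr cat_asg; apply: funext => i /=.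
    by rewrite cat_asg_lshift.
  by rewrite cat_asg_rshift.
elim: p k f v => //= {n}.
- by move=> n t u k f v; rewrite !eval_rename.
- move=> n r ts k f v.
  by under eq_fun do rewrite eval_rename.
- by move=> n p IHp q IHq k f v; rewrite IHp IHq.
- by move=> n p IH k f v; split => H a; have := H a; rewrite IH lift_renameE.
Qed.

End Renaming.

(* Quantifiers in [P] may range over assignments, that is, bind several
   variables at once. *)
Definition expressible (L : signature) n
    (P : forall T, interp L T -> ('I_n -> T) -> Prop) :=
  exists p : formula L n, forall T I v, P T I v <-> sat I p v.

(** * First-order expressible properties and their transfer *)

Section Expressible.
Variable L : signature.
Implicit Types n k : nat.

Lemma expressible_eq n (i i' : 'I_n) :
  expressible (fun T (_ : interp L T) (v : 'I_n -> T) => v i = v i').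
Proof. by exists (Equ (Var L i) (Var L i')). Qed.

(** [F] is left general because concatenated assignments agree with some [v \o f] only up to a
    provable equation. *)
Lemma expressible_sat n k (p : formula L k)
    (F : forall T, ('I_n -> T) -> 'I_k -> T) (f : 'I_k -> 'I_n) :
  (forall T v, F T v = v \o f) ->
  expressible (fun T (I : interp L T) v => sat I p (F T v)).
Proof. by move=> FE; exists (rename p f) => T I v; rewrite sat_rename FE. Qed.

Lemma expressible_imp n (P Q : forall T, interp L T -> ('I_n -> T) -> Prop) :
  expressible P -> expressible Q ->
  expressible (fun T I v => P T I v -> Q T I v).
Proof.
by move=> [p pP] [q qQ]; exists (Imp p q) => T I v /=; rewrite pP qQ.
Qed.

Lemma expressible_not n (P : forall T, interp L T -> ('I_n -> T) -> Prop) :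
  expressible P -> expressible (fun T I v => ~ P T I v).
Proof. by move=> eP; apply: expressible_imp => //; exists (Fls L n). Qed.

Lemma expressible_and n (P Q : forall T, interp L T -> ('I_n -> T) -> Prop) :
  expressible P -> expressible Q ->
  expressible (fun T I v => P T I v /\ Q T I v).
Proof.
move=> eP eQ.
(* The primitive connectives are [Imp] and [Fls], so the conjunction is coded as the negation of [P]
   implying not [Q]. *)
have [r rP] := expressible_not (expressible_imp eP (expressible_not eQ)).
exists r => T I v; rewrite -rP; split; first by move=> [p q] /(_ p).
by move=> npq; split; apply: contrapT => H; apply: npq.
Qed.

(** By induction on [k], a block of [k] quantifiers becomes [k] nested [All]; the block takes the
    first [k] indices because [All] binds index 0. *)
Lemma expressible_all n k
    (P : forall T, interp L T -> ('I_k -> T) -> ('I_n -> T) -> Prop) :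
  expressible (fun T I (w : 'I_(k + n) -> T) =>
    P T I (w \o @lshift k n) (w \o @rshift k n)) ->
  expressible (fun T I v => forall a, P T I a v).
Proof.
move=> [p pP].
have {}pP T I a v : P T I a v <-> sat I p (cat_asg a v).
  rewrite -pP; suff [-> ->] : cat_asg a v \o @lshift k n = a /\
    cat_asg a v \o @rshift k n = v by [].
  by split; apply: funext => i /=; rewrite ?cat_asg_lshift ?cat_asg_rshift.
suff [q qP] : expressible (fun T I (v : 'I_n -> T) =>
    forall a : 'I_k -> T, sat I p (cat_asg a v)).
  by exists q => T I v; rewrite -qP; split=> H a; move: (H a); rewrite pP.
elim: k {P pP} p => [|k IH] p.
  have cat0 T (a : 'I_0 -> T) (v : 'I_n -> T) : cat_asg a v = v.
    apply: funext => i; rewrite -[X in cat_asg a v X](_ : rshift 0 i = i).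
      by rewrite cat_asg_rshift.
    exact: val_inj.
  exists p => T I v; split => [H|H a]; last by rewrite cat0.
  (* Even an empty block has to be instantiated, so the assignment on ['I_0] is produced
     explicitly. *)
  have [a] : exists a : 'I_0 -> T, True by unshelve eexists; [case|].
  by rewrite -(cat0 _ a v).
(* [k.+1 + n] is convertible to [1 + (k + n)], so [p] can be the body of [All]. Associativity of
   concatenation still requires comparing indices by value. *)
have [q qP] := IH (All p); exists q => T I v; rewrite -qP /=.
have catA (a : 'I_1 -> T) (b : 'I_k -> T) :
    cat_asg a (cat_asg b v) = cat_asg (cat_asg a b) v :> ('I_(k.+1 + n) -> T).
  apply: cat_asgP; apply: funext => i /=.
    rewrite -[i in RHS](@splitK 1 k) /unsplit.
    case: (@splitP 1 k i) => i' ii'.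
      rewrite cat_asg_lshift -(cat_asg_lshift a (cat_asg b v) i').
      by congr cat_asg; apply: val_inj.
    rewrite cat_asg_rshift -(cat_asg_lshift b v i').
    rewrite -(cat_asg_rshift a (cat_asg b v)).
    by congr cat_asg; apply: val_inj.
  rewrite -(cat_asg_rshift b v i) -(cat_asg_rshift a (cat_asg b v)).
  by congr cat_asg; apply: val_inj.
split=> [H a b|H a]; first by rewrite catA.
by rewrite -(@cat_asgK T 1 k a) -catA -[_ \o @lshift 1 k]pt_eta.
Qed.

Lemma expressible_ex n k
    (P : forall T, interp L T -> ('I_k -> T) -> ('I_n -> T) -> Prop) :
  expressible (fun T I (w : 'I_(k + n) -> T) =>
    P T I (w \o @lshift k n) (w \o @rshift k n)) ->
  expressible (fun T I v => exists a, P T I a v).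
Proof.
move=> eP; have [p pP] : expressible (fun T I v => ~ forall a, ~ P T I a v).
  exact/expressible_not/expressible_all/expressible_not.
exists p => T I v; rewrite -pP; split=> [[a Pa] /(_ a)//|].
by move=> H; apply: contrapT => H'; apply: H => a Pa; apply: H'; exists a.
Qed.

(** One formula expresses [P] in all structures, so elementarity transfers it in both directions. *)
Lemma elementary_expressible (K M : Type) (IK : interp L K) (IM : interp L M)
    (j : K -> M) n (P : forall T, interp L T -> ('I_n -> T) -> Prop) v :
  elementary IK IM j -> expressible P -> P K IK v <-> P M IM (j \o v).
Proof. by move=> jE [p pP]; rewrite !pP; apply: jE. Qed.

End Expressible.

(** * First-order forms of topological statements *)

Definition basic (L : signature) m (Phi : formula L (1 + m)) (T : Type)
    (I : interp L T) (c : 'I_m -> T) : set T :=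
  [set x | sat I Phi (cat_asg (pt x) c)].

Section Transfer.
Variables (L : signature) (m : nat) (Phi : formula L (1 + m)).

Lemma expressible_cat n k l (p : formula L (k + l)) (f : 'I_k -> 'I_n)
    (g : 'I_l -> 'I_n) :
  expressible (fun T (I : interp L T) v => sat I p (cat_asg (v \o f) (v \o g))).
Proof.
apply: (@expressible_sat L n (k + l) p
  (fun T v => cat_asg (v \o f) (v \o g)) (cat_asg f g)) => T v.
by rewrite comp_cat_asg.
Qed.

Lemma expressible_basic n (i : 'I_n) (g : 'I_m -> 'I_n) :
  expressible (fun T (I : interp L T) v => basic Phi I (v \o g) (v i)).
Proof. exact: (expressible_cat Phi (pt i)). Qed.

(** A first-order consequence of points being closed and not isolated, phrased with basic open sets
    only so that it passes from [K] to [M]. *)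
Definition basic_removal T (I : interp L T) :=
  forall (c : 'I_m -> T) (d : T), (exists x, basic Phi I c x) ->
  exists c', (exists x, basic Phi I c' x) /\
    (forall x, basic Phi I c' x -> basic Phi I c x /\ x <> d).

(** When the sets [basic Phi I c] form a basis, this says that the set defined by [p] with
    parameters [v] has non-empty interior. *)
Definition basic_inside k (p : formula L (1 + k)) T (I : interp L T) v :=
  exists c, (exists x, basic Phi I c x) /\
    (forall x, basic Phi I c x -> sat I p (cat_asg (pt x) v)).

Lemma expressible_basic_removal :
  expressible (fun T I (_ : 'I_0 -> T) => basic_removal I).
Proof.
(* Elements are recast as assignments on ['I_1], since [expressible_all] and [expressible_ex]
   quantify over assignments. *)
suff [p pP] : expressible (fun T (I : interp L T) (_ : 'I_0 -> T) =>
    forall (c : 'I_m -> T) (d : 'I_1 -> T),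
    (exists x : 'I_1 -> T, basic Phi I c (x ord0)) ->
    exists c', (exists x : 'I_1 -> T, basic Phi I c' (x ord0)) /\
    (forall x : 'I_1 -> T, basic Phi I c' (x ord0) ->
      basic Phi I c (x ord0) /\ x ord0 <> d ord0)).
  exists p => T I v; rewrite -pP.
  split=> H c d [x cx].
    have [|c' [[y c'y] H']] := H c (d ord0); first by exists (x ord0).
    by exists c'; split=> [|z /H'//]; exists (pt y).
  have [|c' [[y c'y] H']] := H c (pt d); first by exists (pt x).
  by exists c'; split=> [|z c'z]; [exists (y ord0)|apply: (H' (pt z))].
apply: expressible_all; apply: expressible_all; apply: expressible_imp.
  apply: expressible_ex; exact: expressible_basic.
apply: expressible_ex; apply: expressible_and.
  apply: expressible_ex; exact: expressible_basic.
apply: expressible_all; apply: expressible_imp; first exact: expressible_basic.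
apply: expressible_and; first exact: expressible_basic.
apply: expressible_not; exact: expressible_eq.
Qed.

Lemma expressible_basic_inside k (p : formula L (1 + k)) :
  expressible (basic_inside p).
Proof.
suff [q qP] : expressible (fun T (I : interp L T) (v : 'I_k -> T) =>
    exists c, (exists x : 'I_1 -> T, basic Phi I c (x ord0)) /\
    (forall x : 'I_1 -> T, basic Phi I c (x ord0) -> sat I p (cat_asg x v))).
  exists q => T I v; rewrite -qP.
  split=> -[c [[x cx] H]]; exists c.
    by split=> [|y /H]; [exists (pt x)|rewrite pt_eta].
  by split=> [|y cy]; [exists (x ord0)|apply: H].
apply: expressible_ex; apply: expressible_and.
  apply: expressible_ex; exact: expressible_basic.
apply: expressible_all; apply: expressible_imp; first exact: expressible_basic.
exact: expressible_cat.
Qed.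

End Transfer.

(* Equivalently, the closure of [D] has empty interior. *)
Definition nowhere_dense (T : topologicalType) (D : set T) :=
  forall U : set T, open U -> U !=set0 ->
  exists W, [/\ open W, W !=set0, W `<=` U & W `&` D = set0].

(** * Nowhere dense sets and discrete sets *)

Section NowhereDense.
Variable T : topologicalType.
Implicit Types D E U W : set T.

Lemma nowhere_dense0 : nowhere_dense (@set0 T).
Proof. by move=> U oU U0; exists U; split=> //; rewrite setI0. Qed.

Lemma nowhere_denseS D E : D `<=` E -> nowhere_dense E -> nowhere_dense D.
Proof.
move=> DE nE U oU /(nE _ oU)[W [oW W0 WU WE]]; exists W; split=> //.
by rewrite -subset0 -WE; apply: setIS.
Qed.

Lemma nowhere_denseU D E :
  nowhere_dense D -> nowhere_dense E -> nowhere_dense (D `|` E).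
Proof.
move=> nD nE U oU /(nD _ oU)[V [oV V0 VU VD]].
have [W [oW W0 WV WE]] := nE _ oV V0.
exists W; split=> //; first exact: subset_trans VU.
by rewrite setIUr WE setU0 -subset0 -VD; apply: setSI.
Qed.

Lemma nowhere_dense_bigcup (J : Type) (F : set J) (D : J -> set T) :
  finite_set F -> (forall i, F i -> nowhere_dense (D i)) ->
  nowhere_dense (\bigcup_(i in F) D i).
Proof.
(* Listing a finite set needs decidable equality, so [J] is given a classical choice structure. *)
elim/Pchoice: J => J in F D *; move=> /finite_seqP[s ->] nD {F}.
rewrite bigcup_seq big_seq; elim/big_ind: _ => //.
- exact: nowhere_dense0.
- exact: nowhere_denseU.
Qed.

Lemma nowhere_dense_interior D U :
  nowhere_dense D -> open U -> U !=set0 -> exists2 x, U x & ~ D x.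
Proof.
move=> nD oU /(nD _ oU)[W [_ [x Wx] WU WD]]; exists x; first exact: WU.
by move=> Dx; suff : (W `&` D) x by rewrite WD.
Qed.

(** Deleting [x] from [U] leaves an open set; were it empty, [U] would be a singleton, hence an
    isolated point. *)
Lemma T1_removal :
  (forall x : T, closed [set x]) -> isolated [set: T] = set0 ->
  forall U x, open U -> U !=set0 ->
    exists W, [/\ open W, W !=set0, W `<=` U & ~ W x].
Proof.
move=> T1 noiso U x oU [u Uu]; exists (U `&` ~` [set x]); split.
- by apply: openI => //; rewrite openC; apply: T1.
- apply: contrapT => /set0P/negP/negPn/eqP W0.
  have Ux y : U y -> y = x.
    move=> Uy; apply: contrapT => yx.
    by suff : (U `&` ~` [set x]) y by rewrite W0.
  suff : isolated [set: T] u by rewrite noiso.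
  split; first exact: in_setT.
  exists U; first exact: (open_nbhs_nbhs (conj oU Uu)).
  rewrite setIT; apply/seteqP; split => y /=; last by move=> ->.
  by move=> /Ux ->; rewrite (Ux u Uu).
- exact: subIsetl.
- by move=> [_]; apply.
Qed.

(** If [U] meets [D] at [d], some neighbourhood [V] of [d] meets [D] only there, so removing [d]
    inside [U] and the interior of [V] avoids [D]. Removal is assumed in place of T1 because for [M]
    it is obtained by transfer. *)
Lemma discrete_nowhere_dense D :
  (forall U x, open U -> U !=set0 ->
    exists W, [/\ open W, W !=set0, W `<=` U & ~ W x]) ->
  discrete_set D -> nowhere_dense D.
Proof.
move=> removal dD U oU U0.
have [UD0|/eqP/set0P[d [Ud Dd]]] := pselect (U `&` D = set0).
  by exists U; split.
move: Dd; rewrite -{1}dD => -[_ [V Vd VD]].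
have [||W [oW W0 WUV Wd]] := removal (U `&` V°) d.
- by apply: openI => //; exact: open_interior.
- by exists d.
exists W; split=> //; first by move=> x /WUV[].
rewrite -subset0 => x [Wx Dx]; have [_ /interior_subset Vx] := WUV _ Wx.
by apply: Wd; suff : (V `&` D) x by rewrite VD => /= <-.
Qed.

End NowhereDense.

(** * The topology generated by [Phi] *)

Section Basis.
Variables (L : signature) (m : nat) (Phi : formula L (1 + m)).
Variables (T : topologicalType) (I : interp L T).
Hypothesis topT : fo_topological Phi I.

Lemma open_basic c : open (basic Phi I c).
Proof. by apply: topT.1; exists c. Qed.

Lemma nbhs_basic (U : set T) x :
  nbhs x U -> exists2 c, basic Phi I c x & basic Phi I c `<=` U.
Proof. by move=> /(topT.2 x)[V [[c ->] cx] cU]; exists c. Qed.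

Lemma T1_basic_removal :
  (forall x : T, closed [set x]) -> isolated [set: T] = set0 ->
  basic_removal Phi I.
Proof.
move=> T1 noiso c d [x cx].
have [|W [oW [w Ww] Wc Wd]] := T1_removal T1 noiso d (open_basic c).
  by exists x.
have [c' c'w c'W] := nbhs_basic (open_nbhs_nbhs (conj oW Ww)).
exists c'; split; first by exists w.
by move=> y /c'W Wy; split; [exact: Wc|move=> yd; apply: Wd; rewrite -yd].
Qed.

Lemma basic_removal_discrete (D : set T) :
  basic_removal Phi I -> discrete_set D -> nowhere_dense D.
Proof.
move=> removal; apply: discrete_nowhere_dense => U x oU [u Uu].
have [c cu cU] := nbhs_basic (open_nbhs_nbhs (conj oU Uu)).
have [|c' [c'0 H]] := removal c x; first by exists u.
exists (basic Phi I c'); split=> //; first exact: open_basic.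
- by move=> y /H[/cU].
- by move=> /H[].
Qed.

End Basis.

(** * Definable sets and dimension in the monster model *)

Section Pformula.
Variables (L : signature) (T : Type) (I : interp L T).

Lemma set_pow1_pset (p : pformula L T 1) :
  set_pow1 [set x | pset I p (pt x)] = pset I p.
Proof. by apply/seteqP; split=> x; rewrite /set_pow1 /= pt_eta. Qed.

Definition pf_not n (p : pformula L T n) : pformula L T n :=
  PFormula (Imp (pf_fml p) (Fls L _)) (@pf_par L T n p).

End Pformula.

Section Monster.
Variables (L : signature) (m : nat) (Phi : formula L (1 + m)).
Variables (K M : topologicalType) (IK : interp L K) (IM : interp L M).
Variables (kappa : Type) (j : K -> M).
Hypotheses (topK : fo_topological Phi IK) (topM : fo_topological Phi IM).
Hypotheses (monM : monster kappa IK IM j) (dminK : d_minimal IK IM).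

(** The discrete pieces live in [M], while the separation clauses of [d_minimal] concern [K]; the
    sentence [basic_removal] bridges the two. *)
Lemma definable_nowhere_dense (Z : set M) :
  definable IM (set_pow1 Z) -> Z° = set0 -> nowhere_dense Z.
Proof.
move=> defZ Z0; have [N [D [discD ->]]] := dmin_finite_union dminK defZ Z0.
apply: nowhere_dense_bigcup => [|i _]; first exact: finite_finset.
apply: (basic_removal_discrete topM) => //.
have v0 : 'I_0 -> K by case.
apply/(elementary_expressible v0 (monster_elementary monM)
  (expressible_basic_removal Phi)).
exact: (T1_basic_removal topK (dmin_T1 dminK) (dmin_no_isolated dminK)).
Qed.

(** Saturation is applied to [q] together with the negations of all thin formulas over [A]: finitely
    many nowhere dense sets cannot cover a non-empty open set. *)
Lemma generic_point (A : set M) (q : pformula L M 1) :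
  small kappa A -> par_in A q -> open [set x | pset IM q (pt x)] ->
  [set x | pset IM q (pt x)] !=set0 ->
  exists2 b, pset IM q (pt b) & ~ Zcl IM A b.
Proof.
move=> smallA qA oq q0.
pose thin := [set r | par_in A r /\ [set x | pset IM r (pt x)]° = set0].
have nd r : thin r -> nowhere_dense [set x | pset IM r (pt x)].
  move=> [_ r0]; apply: definable_nowhere_dense => //.
  by exists r => //; rewrite set_pow1_pset.
have [||b bP] := monster_saturated monM smallA
    (p := [set q] `|` [set pf_not r | r in thin]).
- by move=> _ [->//|[r [rA _] <-]].
- move=> F finF Fp.
  have finG : finite_set (F `&` [set pf_not r | r in thin]).
    exact: finite_setIl.
  (* The union is indexed by the negated formulas in [F], so the complement of each solution set is
     the thin set that was negated. *)
  have ndG : nowhere_dense (\bigcup_(r in F `&` [set pf_not r | r in thin])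
      [set x | ~ pset IM r (pt x)]).
    apply: nowhere_dense_bigcup => // _ [_ [r /nd rN <-]].
    by apply: nowhere_denseS rN => x /= /contrapT.
  have [x qx xG] := nowhere_dense_interior ndG oq q0.
  exists x => r Fr; have [->//|rthin] := Fp _ Fr.
  by apply: contrapT => rx; apply: xG; exists r.
- exists b; first by apply: bP; left.
  move=> [Z [[r rA Zr] Z0 Zb]].
  have ZE : Z = [set x | pset IM r (pt x)] by rewrite -Zr.
  have /bP : ([set q] `|` [set pf_not r | r in thin]) (pf_not r).
    by right; exists r => //; split=> //; rewrite -ZE.
  by apply; move: Zb; rewrite ZE.
Qed.

Lemma interior_is_dim1 (A : set M) (q : pformula L M 1) :
  small kappa A -> par_in A q -> open [set x | pset IM q (pt x)] ->
  [set x | pset IM q (pt x)] !=set0 ->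
  is_dim kappa IM (pset IM q) (Some 1).
Proof.
move=> smallA qA oq q0; have [b qb bA] := generic_point smallA qA oq q0.
exists A; split=> //; first by exists q.
split=> [|v r _ [S _ <-]]; last by rewrite -[leqRHS](card_ord 1) max_card.
exists (pt b) => //; exists [set: 'I_1]%SET; last by rewrite cardsT card_ord.
apply/maxsetP; split=> [|S _ TS]; last first.
  by apply/eqP; rewrite finset.eqEsubset finset.subsetT.
(* With a single coordinate no other entry is added to [A], so independence just says that [b]
   avoids [Zcl IM A]. *)
apply/asboolP => i _; rewrite (_ : _ `|` _ = A) //.
by apply/setUidl => x [k /= [_]]; rewrite !ord1.
Qed.

Lemma is_dim1_interior (q : pformula L M 1) :
  is_dim kappa IM (pset IM q) (Some 1) ->
  exists x, [set x | pset IM q (pt x)]° x.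
Proof.
move=> [A [_ [r rA qr] [[b qb [S maxS S1]] _]]].
apply/set0P/negP => /eqP q0.
have /card_gt0P[i iS] : 0 < #|S| by rewrite S1.
have /asboolP/(_ i iS) := maxsetp maxS; apply.
exists [set x | pset IM q (pt x)]; split=> //.
  (* Definability over [A] is certified by [r], since the parameters of [q] need not lie in [A]. *)
  by exists r; [move=> k; left|rewrite set_pow1_pset].
by rewrite /= (ord1 i) pt_eta.
Qed.

End Monster.

Theorem lemma9p12 (L : signature) (m : nat) (Phi : formula L (1 + m))
    (K M : topologicalType) (IK : interp L K) (IM : interp L M)
    (kappa : Type) (j : K -> M)
    (topK : fo_topological Phi IK) (topM : fo_topological Phi IM)
    (monM : monster kappa IK IM j)
    (dminK : d_minimal IK IM)
    (X : set K) :
  Zcl_dense kappa IK IM j X <-> dense X.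
Proof.
have jE := monster_elementary monM.
split=> [XZ O [x Ox] oO|Xd U p Up /is_dim1_interior[z pz]].
  (* [Zcl_dense] speaks of definable sets, so the open set is first shrunk to a basic one. *)
  have [c cx cO] := nbhs_basic topK (open_nbhs_nbhs (conj oO Ox)).
  pose p : pformula L K 1 := @PFormula L K 1 m Phi c.
  suff pdim : is_dim kappa IM (pset IM (pf_map j p)) (Some 1).
    have [|y [cy Xy]] := XZ (basic Phi IK c) p _ pdim.
      exact: set_pow1_pset IK p.
    by exists y; split=> //; apply: cO.
  (* The parameters of [pf_map j p] lie in the image of [j], which is small because [K] is. *)
  apply: (interior_is_dim1 topK topM monM dminK (A := range j)).
  - have /andP[leK gtK] := monster_large_K monM.
    have jK : (range j #<= [set: K])%card := card_image_le j setT.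
    rewrite /small /card_lt (card_le_trans jK leK) /=.
    by apply: contra gtK => /card_le_trans; apply.
  - by move=> i; exists (c i).
  - exact: (open_basic topM (j \o c)).
  - exists (j x); move/(jE _ Phi): cx; rewrite comp_cat_asg.
    by congr (sat _ _ (cat_asg _ _)).
(* Here [c] lies in [M]; elementarity of [basic_inside] replaces it by some [d] in [K] whose basic
   set is non-empty and contained in [U]. *)
have [c cz cp] := nbhs_basic topM pz.
have [] : basic_inside Phi (pf_fml p) IK (@pf_par L K 1 p).
  apply/(elementary_expressible _ jE (expressible_basic_inside Phi (pf_fml p))).
  by exists c; split; first by exists z.
move=> d [[y dy] dU].
have [x [dx Xx]] := Xd _ (ex_intro _ y dy) (open_basic topK d).
exists x; split=> //.
suff : set_pow1 U (pt x) by [].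
by rewrite Up; apply: dU.
Qed.
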